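(* For $n\ge1$ let $\chi_n=\sum_{k=0}^{\lfloor n/2\rfloor}(-1)^k\frac{n!}{2^k}\binom{n-k}{k}$. Then $\chi_1=\chi_2=1$ and $\chi_n=n\,\chi_{n-1}-\binom{n}{2}\chi_{n-2}$ for all $n\ge3$. *)

(* Defs.v *)
From mathcomp Require Import all_boot all_order all_algebra.

Set Implicit Arguments.
Unset Strict Implicit.
Unset Printing Implicit Defensive.

Import GRing.Theory.

Local Open Scope ring_scope.

(* The quotients n! / 2^k are taken in the field of rationals. *)
Definition chi (n : nat) : rat :=
  \sum_(0 <= k < (n %/ 2).+1)
    (-1) ^+ k * ((n`!)%:R / 2%:R ^+ k) * 'C(n - k, k)%:R.

(* Main.v *)
Require Import Defs.
From mathcomp Require Import all_boot all_order all_algebra.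
From mathcomp Require Import ring zify.

Import GRing.Theory.

Local Open Scope ring_scope.

(** Write chi_n = n! S_n with S_n = \sum_k (-1/2)^k C(n-k, k). Pascal's rule
    gives S_{n+2} = S_{n+1} - S_n / 2, and multiplying by (n+2)! gives the
    recurrence for chi, since C(n+2, 2) n! = (n+2)! / 2. *)

(* The terms with n < 2k vanish, so the bound N is free; truncated subtraction
   is harmless because n - k < k still holds for them. *)
Lemma chi_factorial_sum (n N : nat) : (n %/ 2 < N)%N ->
  chi n = n`!%:R * \sum_(0 <= k < N) (- 2^-1) ^+ k * 'C(n - k, k)%:R.
Proof.
move=> ltnN; rewrite (big_cat_nat (n := (n %/ 2).+1)) //=.
rewrite [X in _ + X]big_nat_cond [X in _ + X]big1 ?addr0 => [|k].
  rewrite /chi mulr_sumr; apply: eq_bigr => k _.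
  by rewrite -[- 2^-1]mulN1r exprMn exprVn; ring.
by rewrite andbT => /andP[ltnk _]; rewrite bin_small ?mulr0 //; lia.
Qed.

(** The [k = 0] terms agree. For [k = j + 1] Pascal's rule splits [C(n + 1 - j, j + 1)], and the
    piece [C(n - j, j)] carries the extra factor [x]. *)
Lemma sum_bin_diag_rec (R : pzRingType) (x : R) (n : nat) :
  \sum_(0 <= k < n.+2) x ^+ k * 'C(n.+2 - k, k)%:R =
  \sum_(0 <= k < n.+2) x ^+ k * 'C(n.+1 - k, k)%:R +
  x * \sum_(0 <= k < n.+1) x ^+ k * 'C(n - k, k)%:R.
Proof.
rewrite [in LHS]big_nat_recl // [X in _ = X + _]big_nat_recl //.
rewrite !bin0 -addrA; congr (_ + _).
rewrite mulr_sumr -big_split /=.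
apply: eq_big_nat => j /andP[_ ltjn].
by rewrite subSS subSn // binS natrD mulrDr exprS mulrA.
Qed.

Lemma chi_rec (n : nat) :
  chi n.+2 = n.+2%:R * chi n.+1 - 'C(n.+2, 2)%:R * chi n.
Proof.
(* The three bounds are those of [sum_bin_diag_rec], used at [x = -1/2]. *)
rewrite (@chi_factorial_sum n.+2 n.+2); last by lia.
rewrite (@chi_factorial_sum n.+1 n.+2); last by lia.
rewrite (@chi_factorial_sum n n.+1); last by lia.
have binF : 'C(n.+2, 2)%:R * n`!%:R = n.+2`!%:R / 2%:R :> rat.
  rewrite -(bin_fact (isT : (2 <= n.+2)%N)) subSS subSS subn0 !natrM.
  by field.
rewrite sum_bin_diag_rec [in X in _ = _ - X]mulrA binF factS natrM.
by field.
Qed.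

Theorem theorem6p3 :
  chi 1 = 1 /\ chi 2 = 1 /\
  (forall n : nat, (3 <= n)%N ->
     chi n = n%:R * chi (n - 1)%N - 'C(n, 2)%:R * chi (n - 2)%N).
Proof.
have chi0 : chi 0 = 1 by rewrite /chi big_nat1.
have chi1 : chi 1 = 1 by rewrite /chi big_nat1.
(* The recurrence also holds at index 2, where it reads [chi 2 = 2 * chi 1 - chi 0 = 1]. *)
split=> //; split; first by rewrite chi_rec chi0 chi1.
by case=> [|[|n]] // _; rewrite subn1 subn2 chi_rec.
Qed.
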